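(* For every real number $p$ with $1 < p < \infty$ there exists a constant $C_p > 0$, depending only on $p$ (and in particular not on $N$ or $f$), such that for every integer $N \geq 1$ and every function $f : \{0,1\}^N \to \mathbb{C}$, \[ \| f^* \|_{L^p(\{0,1\}^N)} \leq C_p \, \| f \|_{L^p(\{0,1\}^N)}, \] where $f^*(x) := \sup_{0 \leq k \leq N/2} |\sigma_k * f(x)|$.
   Context: $\mathbb{I}^N = \{0,1\}^N$ is the $N$-dimensional hypercube, viewed as the group $(\mathbb{Z}/2\mathbb{Z})^N$ (addition and subtraction are componentwise mod 2). For $y \in \mathbb{I}^N$, $|y| := \#\{1 \leq i \leq N : y(i) = 1\}$. Norms are with respect to counting measure: $\|f\|_{L^p(\mathbb{I}^N)} := \left(\sum_{x \in \mathbb{I}^N} |f(x)|^p\right)^{1/p}$ for $1 \leq p < \infty$. For an integer $0 \leq k \leq N$, $\sigma_k := \binom{N}{k}^{-1} \mathbf{1}_{\{x \in \mathbb{I}^N : |x| = k\}}$ is the normalized indicator function of the $k$-sphere, and convolution is $\sigma_k * f(x) := \sum_{y \in \mathbb{I}^N} f(x-y)\sigma_k(y)$. The supremum in $f^*$ is over integers $k$. *)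

(* Defs.v *)
From mathcomp Require Export all_boot all_order all_algebra.
From mathcomp Require Export boolp classical_sets reals exp.
From mathcomp Require Export complex.

Set Implicit Arguments.
Unset Strict Implicit.
Unset Printing Implicit Defensive.

Import Order.TTheory GRing.Theory Num.Theory.
Local Open Scope classical_set_scope.
Local Open Scope ring_scope.

(* {0,1}^N as the group (Z/2Z)^N: subtraction of row vectors over 'F_2 is
   componentwise mod 2. *)
Notation hypercube N := 'rV['F_2]_N.

Definition weight (N : nat) (y : hypercube N) : nat :=
  #|[set i : 'I_N | y ord0 i == 1]%SET|.

(* Normc.normc is the R-valued complex modulus; the generic norm `|z| of
   z : R[i] is again an element of R[i]. *)
Definition Lp_norm (R : realType) (N : nat) (p : R)
    (f : hypercube N -> R[i]) : R :=
  (\sum_(x : hypercube N) Normc.normc (f x) `^ p) `^ p^-1.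

Definition sphere_avg (R : realType) (N k : nat) (y : hypercube N) : R[i] :=
  ('C(N, k)%:R)^-1 * (weight y == k)%:R.

Definition conv (R : realType) (N : nat) (g f : hypercube N -> R[i])
    (x : hypercube N) : R[i] :=
  \sum_(y : hypercube N) f (x - y) * g y.

(* The set is finite and nonempty (it contains the value at k = 0), so the real
   supremum is a genuine one. *)
Definition spherical_maximal (R : realType) (N : nat) (f : hypercube N -> R[i])
    (x : hypercube N) : R :=
  sup [set Normc.normc (conv (sphere_avg R k) f x)
      | k in [set k : nat | k%:R <= N%:R / 2 :> R]].

(* Main.v *)
Require Import Defs.
From mathcomp Require Import all_fingroup.
From mathcomp Require Import ring lra zify.

Set Implicit Arguments.
Unset Strict Implicit.
Unset Printing Implicit Defensive.

Import Order.TTheory GRing.Theory Num.Theory.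
Local Open Scope ring_scope.
Local Open Scope complex_scope.

(* The operators T_k T_k^*, where T_k averages over k independent random steps,
   satisfy a maximal inequality with a constant depending on p only: T_k T_k^* f
   is the average of the k-th term of a reverse martingale (Rota), to which
   Doob's inequality applies. Two such walks on disjoint sets of coordinates are
   composed. The outer one moves in pairs of coordinates, and after b steps it
   sits at distance 2 Bin(b, 1/2), a window of width O(sqrt N). The inner one
   moves in O(sqrt N) groups of O(sqrt N) coordinates, where k <= O(sqrt N)
   steps travel distance exactly 2k with probability at least 1/2; since the
   inner maximal function dominates all these k at once, it corrects the
   fluctuation of the outer walk. Finitely many translations supply the parity
   and the bulk of the radius. After averaging over permutations of the
   coordinates, the composed maximal function dominates every spherical mean of
   radius at most N/2 up to an absolute constant. *)

(** * Finite averages, with the inequalities of Young and Jensen *)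

Section Mean.
Context {R : realType}.

Definition mean (I : finType) (F : I -> R) : R := (\sum_i F i) / #|I|%:R.

Lemma ler_mean (I : finType) (F G : I -> R) :
  (forall i, F i <= G i) -> mean F <= mean G.
Proof. by move=> le_FG; rewrite ler_wpM2r ?invr_ge0 ?ler0n// ler_sum. Qed.

Lemma mean_ge0 (I : finType) (F : I -> R) : (forall i, 0 <= F i) -> 0 <= mean F.
Proof. by move=> F_ge0; rewrite divr_ge0 ?ler0n// sumr_ge0. Qed.

Lemma eq_mean (I : finType) (F G : I -> R) : F =1 G -> mean F = mean G.
Proof. by move=> eFG; rewrite /mean (eq_bigr G). Qed.

Lemma exchange_mean (I J : finType) (F : I -> J -> R) :
  mean (fun i => mean (F i)) = mean (fun j => mean (F^~ j)).
Proof.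
by rewrite /mean -!mulr_suml exchange_big/= mulrAC.
Qed.

Lemma sum_mean (I J : finType) (F : I -> J -> R) :
  \sum_j mean (F^~ j) = mean (fun i => \sum_j F i j).
Proof. by rewrite /mean -mulr_suml exchange_big. Qed.

Lemma mean_cst (I : finType) (c : R) : (0 < #|I|)%N -> mean (fun _ : I => c) = c.
Proof.
move=> I_gt0; rewrite /mean sumr_const -[c *+ _]mulr_natr mulfK//.
by rewrite pnatr_eq0 -lt0n.
Qed.

Lemma meanD (I : finType) (F G : I -> R) :
  mean (fun i => F i + G i) = mean F + mean G.
Proof. by rewrite /mean big_split mulrDl. Qed.

Lemma meanZ (I : finType) (c : R) (F : I -> R) :
  mean (fun i => c * F i) = c * mean F.
Proof. by rewrite /mean -mulr_sumr mulrA. Qed.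

Lemma max_mean_le (I : finType) (F G : I -> R) :
  Num.max (mean F) (mean G) <= mean (fun i => Num.max (F i) (G i)).
Proof.
by rewrite ge_max !ler_mean// => i; rewrite le_max lexx ?orbT.
Qed.

Lemma mean_ge_term (I : finType) (F : I -> R) i :
  (forall j, 0 <= F j) -> F i / #|I|%:R <= mean F.
Proof.
move=> F_ge0; rewrite ler_wpM2r ?invr_ge0 ?ler0n//.
by rewrite (bigD1 i)//= lerDl sumr_ge0.
Qed.

(** Young's inequality for the conjugate exponents [p / (p - 1)] and [p], multiplied by [p]. It is
    the only convexity input: Jensen's inequality and both Bellman estimates below reduce to it. *)
Lemma young (p a b : R) : 1 < p -> 0 <= a -> 0 <= b ->
  p * (a `^ (p - 1) * b) <= (p - 1) * a `^ p + b `^ p.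
Proof.
move=> p1 a0 b0; have p0 : 0 < p by lra.
have pB0 : 0 < p - 1 by lra.
have pn0 : p != 0 by lra.
have pBn0 : p - 1 != 0 by lra.
have := @conjugate_powR R (a `^ (p - 1)) b (p / (p - 1)) p (powR_ge0 _ _) b0.
rewrite divr_gt0// => /(_ isT p0).
rewrite -powRrM (_ : (p - 1) * (p / (p - 1)) = p); last by field.
rewrite (_ : (p / (p - 1))^-1 + p^-1 = 1); last by field; apply/andP.
move=> /(_ erefl) /(ler_wpM2l (ltW p0)) /le_trans; apply.
by rewrite le_eqVlt; apply/orP; left; apply/eqP; field; apply/andP.
Qed.

Lemma powR_split (p a : R) : 1 < p -> 0 <= a -> a `^ p = a `^ (p - 1) * a.
Proof.
move=> p1; rewrite le_eqVlt => /predU1P[<-|a0]; first by rewrite mulr0 powR0//; lra.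
by rewrite -{3}[a]powRr1 ?ltW// -powRD ?subrK// (gt_eqF a0) implybT.
Qed.

(** Jensen's inequality by the tangent line at the mean: average [young] with [a = mean F] and
    [b = F i] over [i]. *)
Lemma powR_mean_le (I : finType) (p : R) (F : I -> R) :
  1 < p -> (0 < #|I|)%N -> (forall i, 0 <= F i) ->
  mean F `^ p <= mean (fun i => F i `^ p).
Proof.
move=> p1 I_gt0 F0; have m0 := mean_ge0 F0.
have : mean (fun i => p * (mean F `^ (p - 1) * F i)) <=
       mean (fun i => (p - 1) * mean F `^ p + F i `^ p).
  by apply: ler_mean => i; exact: young.
by rewrite meanZ meanZ -powR_split// meanD mean_cst//; lra.
Qed.

End Mean.

(** * Random walks on a finite abelian group and Doob's maximal inequality *)

Section Walk.
Context {R : realType} {V : finZmodType}.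

Definition step (I : finType) (v : I -> V) (h : V -> R) (x : V) : R :=
  mean (fun i => h (x + v i)).

Variables (I : finType) (v : nat -> I -> V).

(** [fwd k] averages over the position after the steps [v 0], ..., [v (k - 1)]; [bwd k] is its
    adjoint for counting measure. For a uniform starting point, [bwd k f] is the conditional
    expectation of [f] at the start given the positions from time [k] on, whence the reverse
    martingale. *)
Fixpoint fwd (k : nat) (h : V -> R) : V -> R :=
  if k is k'.+1 then fwd k' (step (v k') h) else h.

Fixpoint bwd (k : nat) (h : V -> R) : V -> R :=
  if k is k'.+1 then step (fun i => - v k' i) (bwd k' h) else h.

Fixpoint walk_max (k : nat) (f : V -> R) (x : V) : R :=
  if k is k'.+1 then Num.max (walk_max k' f x) (fwd k (bwd k f) x) else f x.

Lemma ler_step (J : finType) (w : J -> V) (h g : V -> R) :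
  (forall x, h x <= g x) -> forall x, step w h x <= step w g x.
Proof. by move=> hg x; apply: ler_mean => i. Qed.

Lemma step_ge0 (J : finType) (w : J -> V) (h : V -> R) :
  (forall x, 0 <= h x) -> forall x, 0 <= step w h x.
Proof. by move=> h0 x; apply: mean_ge0 => i. Qed.

Lemma ler_fwd k (h g : V -> R) :
  (forall x, h x <= g x) -> forall x, fwd k h x <= fwd k g x.
Proof. by elim: k h g => //= k IH h g hg; apply: IH => x; exact: ler_step. Qed.

Lemma ler_bwd k (h g : V -> R) :
  (forall x, h x <= g x) -> forall x, bwd k h x <= bwd k g x.
Proof. by move=> hg; elim: k => //= k IH x; exact: ler_step. Qed.

Lemma fwd_ge0 k (h : V -> R) :
  (forall x, 0 <= h x) -> forall x, 0 <= fwd k h x.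
Proof. by elim: k h => //= k IH h h0; apply: IH => x; exact: step_ge0. Qed.

Lemma bwd_ge0 k (h : V -> R) :
  (forall x, 0 <= h x) -> forall x, 0 <= bwd k h x.
Proof. by move=> h0; elim: k => //= k IH x; exact: step_ge0. Qed.

Lemma walk_max_ge0 k (f : V -> R) :
  (forall x, 0 <= f x) -> forall x, 0 <= walk_max k f x.
Proof. by move=> f0; elim: k => //= k IH x; rewrite le_max IH. Qed.

Lemma ler_walk_max k (h g : V -> R) :
  (forall x, h x <= g x) -> forall x, walk_max k h x <= walk_max k g x.
Proof.
move=> hg; elim: k => //= k IH x; rewrite ge_max !le_max IH/=.
by rewrite ler_fwd ?orbT// => y; do 2![apply: ler_step => ?]; exact: ler_bwd.
Qed.

Lemma walk_max_ge k n (f : V -> R) x :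
  (k <= n)%N -> fwd k (bwd k f) x <= walk_max n f x.
Proof.
elim: n => [|n IH]; first by rewrite leqn0 => /eqP->.
rewrite leq_eqVlt => /predU1P[->|]; first by rewrite /= le_max lexx orbT.
by move=> /IH /le_trans; apply; rewrite /= le_max lexx.
Qed.

Lemma step_mean (J W : finType) (w : J -> V) (h : W -> V -> R) :
  step w (fun y => mean (h^~ y)) = fun x => mean (fun o => step w (h o) x).
Proof. by apply/funext => x; rewrite /step exchange_mean. Qed.

Lemma fwd_mean (W : finType) k (h : W -> V -> R) :
  fwd k (fun y => mean (h^~ y)) = fun x => mean (fun o => fwd k (h o) x).
Proof. by elim: k h => //= k IH h; rewrite step_mean IH. Qed.

Lemma bwd_mean (W : finType) k (h : W -> V -> R) :
  bwd k (fun y => mean (h^~ y)) = fun x => mean (fun o => bwd k (h o) x).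
Proof. by elim: k => //= k ->; rewrite step_mean. Qed.

(** The averages are linear and a maximum of means is at most the mean of the maxima; this later
    lets the average over permutations leave the maximal function. *)
Lemma walk_max_mean (W : finType) k (h : W -> V -> R) x :
  walk_max k (fun y => mean (h^~ y)) x <= mean (fun o => walk_max k (h o) x).
Proof.
elim: k => //= k IH; apply: le_trans (max_mean_le _ _).
by rewrite ge_max !le_max IH/= bwd_mean !step_mean fwd_mean lexx orbT.
Qed.

Lemma step_comm (J J' : finType) (w : J -> V) (w' : J' -> V) h :
  step w (step w' h) = step w' (step w h).
Proof.
apply/funext => x; rewrite /step exchange_mean; apply: eq_mean => j.
by apply: eq_mean => i; rewrite addrAC.
Qed.

Lemma fwd_step (J : finType) (w : J -> V) k h :
  fwd k (step w h) = step w (fwd k h).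
Proof. by elim: k h => //= k IH h; rewrite step_comm IH. Qed.

(** Steps commute, so the last step and its reversal can be moved outermost together. The lower
    bounds below are inductions on this form. *)
Lemma fwd_bwdS k h :
  fwd k.+1 (bwd k.+1 h) =
  step (v k) (step (fun i => - v k i) (fwd k (bwd k h))).
Proof. by rewrite /= fwd_step fwd_step. Qed.

Lemma step_shift (J : finType) (w : J -> V) (h : V -> R) a :
  step w (fun y => h (a + y)) = fun x => step w h (a + x).
Proof. by apply/funext => x; apply: eq_mean => i; rewrite addrA. Qed.

Lemma fwd_shift k (h : V -> R) a :
  fwd k (fun y => h (a + y)) = fun x => fwd k h (a + x).
Proof. by elim: k h => //= k IH h; rewrite step_shift IH. Qed.

Lemma bwd_shift k (h : V -> R) a :
  bwd k (fun y => h (a + y)) = fun x => bwd k h (a + x).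
Proof. by elim: k => //= k ->; rewrite step_shift. Qed.

Lemma walk_max_shift k (f : V -> R) a :
  walk_max k (fun y => f (a + y)) = fun x => walk_max k f (a + x).
Proof.
by apply/funext => x; elim: k => //= k ->; rewrite bwd_shift !step_shift fwd_shift.
Qed.

Lemma sum_step_powR_le (J : finType) (w : J -> V) (p : R) (f : V -> R) :
  1 < p -> (0 < #|J|)%N -> (forall x, 0 <= f x) ->
  \sum_x step w f x `^ p <= \sum_x f x `^ p.
Proof.
move=> p1 J0 f0.
apply: (@le_trans _ _ (\sum_x mean (fun i => f (x + w i) `^ p))).
  by apply: ler_sum => x _; apply: powR_mean_le.
rewrite (sum_mean (fun i x => f (x + w i) `^ p)) -[leRHS](mean_cst _ J0).
apply: ler_mean => i; rewrite le_eqVlt; apply/orP; left; apply/eqP.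
by rewrite [RHS](reindex_inj (addIr (w i))).
Qed.

(* The Bellman function of Doob's inequality, with [s] the current value of the
   martingale and [r >= s] its running maximum; it is affine in [s]. *)
Definition bellman (p s r : R) : R :=
  p * r `^ p - p * (p / (p - 1)) * (r `^ (p - 1) * s).

(** [young] with [a = r] and [b = p / (p - 1) * s]; used at time 0, where the martingale equals
    [f]. *)
Lemma bellman_start (p s r : R) : 1 < p -> 0 <= s -> 0 <= r ->
  r `^ p <= (p / (p - 1)) `^ p * s `^ p + bellman p s r.
Proof.
move=> p1 s0 r0; have q0 : 0 <= p / (p - 1) by rewrite divr_ge0//; lra.
rewrite -powRM//; have := young p1 r0 (mulr_ge0 q0 s0); rewrite /bellman; lra.
Qed.

(** When [s] exceeds [r], the decrease is [p / (p - 1)] times the gap between the two sides of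
    [young]. *)
Lemma bellman_max (p s r : R) : 1 < p -> 0 <= s -> 0 <= r ->
  bellman p s (Num.max r s) <= bellman p s r.
Proof.
move=> p1 s0 r0; have [//|_] := leP s r.
have pB0 : 0 < p - 1 by lra.
rewrite /bellman -powR_split// -subr_ge0.
have -> : p * r `^ p - p * (p / (p - 1)) * (r `^ (p - 1) * s)
   - (p * s `^ p - p * (p / (p - 1)) * s `^ p) = p / (p - 1) *
   ((p - 1) * r `^ p + s `^ p - p * (r `^ (p - 1) * s)).
  by field; lra.
by rewrite mulr_ge0 ?divr_ge0//; [lra|lra|rewrite subr_ge0 young].
Qed.

Hypothesis I_gt0 : (0 < #|I|)%N.

(* The function [r] carries the running maximum over the later times. *)
Lemma sum_walk_max_bellman (p : R) (f : V -> R) k (r : V -> R) :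
  1 < p -> (forall x, 0 <= f x) -> (forall x, bwd k f x <= r x) ->
  \sum_x (Num.max (walk_max k f x) (fwd k r x)) `^ p <=
  \sum_x ((p / (p - 1)) `^ p * f x `^ p + bellman p (bwd k f x) (r x)).
Proof.
move=> p1 f0; elim: k r => [|k IH] r /= le_r.
  apply: ler_sum => x _; rewrite max_r//; apply: bellman_start => //.
  exact: le_trans (f0 x) (le_r x).
(* If step [k] is [i], the later running maximum seen from position [y] at time [k] is
   [r (y + v k i)]; it now also takes in the value of the martingale at time [k]. *)
pose r' i y := Num.max (r (y + v k i)) (bwd k f y).
have b0 := bwd_ge0 k f0.
have r0 x : 0 <= r x by apply: le_trans (le_r x); exact: step_ge0.
have r'0 i x : 0 <= r' i x by rewrite le_max r0.
have := ler_mean (fun i : I => IH (r' i) _).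
move=> /(_ (fun i x => _)) H.
have {}H : mean (fun i => \sum_x (Num.max (walk_max k f x) (fwd k (r' i) x)) `^ p)
   <= mean (fun i => \sum_x ((p / (p - 1)) `^ p * f x `^ p +
         bellman p (bwd k f x) (r' i x))).
  by apply: H => i x; rewrite le_max lexx orbT.
apply: le_trans (le_trans _ H) _.
  rewrite -(sum_mean (fun i x => _)); apply: ler_sum => x _.
  apply: (@le_trans _ _
    (mean (fun i => Num.max (walk_max k f x) (fwd k (r' i) x)) `^ p)); last first.
    by apply: powR_mean_le => // i; rewrite le_max walk_max_ge0.
  have m0 : 0 <= mean (fun i => Num.max (walk_max k f x) (fwd k (r' i) x)).
    by apply: mean_ge0 => i; rewrite le_max walk_max_ge0.
  apply: ge0_ler_powR; rewrite ?nnegrE ?le_max ?walk_max_ge0//; first lra.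
  apply: le_trans (max_mean_le _ _).
  have le_fr : fwd k (step (fun i => v k i) r) x <= mean (fun i => fwd k (r' i) x).
    rewrite -[leRHS](congr1 (@^~ x) (fwd_mean _ _)); apply: ler_fwd => y.
    by apply: ler_mean => i; rewrite le_max lexx.
  rewrite mean_cst// !ge_max !le_max lexx/= le_fr orbT andbT.
  apply/orP; right; apply: le_trans le_fr; apply: ler_fwd => y.
  exact: ler_step.
apply: (@le_trans _ _ (mean (fun i => \sum_x ((p / (p - 1)) `^ p * f x `^ p +
         bellman p (bwd k f x) (r (x + v k i)))))).
  apply: ler_mean => i; apply: ler_sum => x _; rewrite lerD2l.
  exact: bellman_max.
rewrite (eq_mean (fun i => big_split _ _ _ _ _ )) /= meanD mean_cst// big_split/=.
rewrite lerD2l.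
(* Translating the sum by [v k i] frees [r] from [i]. As [bellman] is affine in [s], averaging over
   [i] then replaces [bwd k f] by [bwd k.+1 f]: this is the martingale property. *)
rewrite (eq_mean (G := fun i => \sum_x bellman p (bwd k f (x - v k i)) (r x))).
  rewrite -(sum_mean (fun i x => bellman p (bwd k f (x - v k i)) (r x))).
  apply: ler_sum => x _; rewrite (eq_mean (G := fun i => p * r x `^ p +
    - (p * (p / (p - 1)) * r x `^ (p - 1)) * bwd k f (x - v k i))).
    by rewrite meanD mean_cst// meanZ mulNr /bellman [_ * (_ * step _ _ _)]mulrA.
  by move=> i; rewrite /bellman mulNr [_ * (_ * bwd _ _ _)]mulrA.
move=> i; rewrite (reindex_inj (addIr (- v k i))); apply: eq_bigr => x _.
by rewrite subrK.
Qed.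

(** Doob's inequality, with a constant free of [k], [v] and [V]. The running maximum is started at
    the last value [s] of the martingale, where [bellman p s s] is [- (p / (p - 1)) * s ^ p], hence
    nonpositive. *)
Theorem sum_walk_max_le (p : R) (f : V -> R) k : 1 < p -> (forall x, 0 <= f x) ->
  \sum_x walk_max k f x `^ p <= (p / (p - 1)) `^ p * \sum_x f x `^ p.
Proof.
move=> p1 f0; have b0 := bwd_ge0 k f0.
have := sum_walk_max_bellman p1 f0 (fun x => lexx (bwd k f x)).
rewrite big_split/= -mulr_sumr => H.
apply: (@le_trans _ _
  (\sum_x (Num.max (walk_max k f x) (fwd k (bwd k f) x)) `^ p)).
  apply: ler_sum => x _; apply: ge0_ler_powR; rewrite ?nnegrE; first lra.
  - exact: walk_max_ge0.
  - by rewrite le_max walk_max_ge0.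
  - by rewrite le_max lexx.
apply: le_trans H _; rewrite gerDl; apply: sumr_le0 => x _.
rewrite /bellman -powR_split//.
have -> : p * bwd k f x `^ p - p * (p / (p - 1)) * bwd k f x `^ p =
  - (p / (p - 1) * bwd k f x `^ p) by field; lra.
by rewrite oppr_le0 mulr_ge0 ?powR_ge0// divr_ge0//; lra.
Qed.

End Walk.

(** The indices of the two steps are independent and uniform; they coincide with probability
    [1 / #|I|], and then the steps cancel. *)
Lemma step_pair_ge (R : realType) (V : finZmodType) (I : finType) (v : I -> V)
    (h : V -> R) x c0 c1 :
  (0 < #|I|)%N -> c0 <= h x ->
  (forall i i', i != i' -> c1 <= h (x + v i - v i')) ->
  #|I|%:R^-1 * c0 + (1 - #|I|%:R^-1) * c1 <= step v (step (fun i => - v i) h) x.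
Proof.
move=> I0 le0 le1; rewrite -[leLHS](mean_cst _ I0); apply: ler_mean => i.
have n0 : #|I|%:R != 0 :> R by rewrite pnatr_eq0 -lt0n.
rewrite /step /mean.
have -> : #|I|%:R^-1 * c0 + (1 - #|I|%:R^-1) * c1 =
    (c0 + \sum_(i' | i' != i) c1) / #|I|%:R.
  rewrite sumr_const cardC1 -[c1 *+ _]mulr_natr -subn1 natrB//.
  by field.
rewrite ler_wpM2r ?invr_ge0 ?ler0n// [leRHS](bigD1 i)//= addrK lerD//.
by apply: ler_sum => i' ii'; apply: le1; rewrite eq_sym.
Qed.

(** * Lower bounds for the composed walks on the cube *)

Section Cube.
Context {N : nat}.
Implicit Types u x y w : hypercube N.

Lemma F2_cases (b : 'F_2) : (b = 0) \/ (b = 1).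
Proof.
by case: b => -[|[|//]] ?; [left|right]; apply/val_inj.
Qed.

Lemma cube_oppr u : - u = u.
Proof.
apply/rowP => j; rewrite mxE; case: (F2_cases (u ord0 j)) => ->; exact/val_inj.
Qed.

(* Zero when [N <= c]. *)
Definition unit_vec (c : nat) : hypercube N := \row_j ((j : nat) == c)%:R.

Definition block_vec (a z : nat) : hypercube N := \sum_(c < z) unit_vec (a + c).

Definition vanishes (A : pred nat) u := forall j : 'I_N, A j -> u ord0 j = 0.

Lemma vanishesD A u w : vanishes A u -> vanishes A w -> vanishes A (u + w).
Proof. by move=> hu hw j Aj; rewrite mxE hu// hw// addr0. Qed.

Lemma vanishes_sub (A B : pred nat) u :
  (forall j, A j -> B j) -> vanishes B u -> vanishes A u.
Proof. by move=> AB hu j /AB; exact: hu. Qed.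

Lemma vanishes_unit (A : pred nat) c : ~~ A c -> vanishes A (unit_vec c).
Proof. by move=> Ac j Aj; rewrite mxE; case: eqP => // jc; rewrite -jc Aj in Ac. Qed.

Lemma vanishes_block (A : pred nat) a z :
  (forall c, (a <= c < a + z)%N -> ~~ A c) -> vanishes A (block_vec a z).
Proof.
move=> hA; rewrite /block_vec; elim/big_ind: _ => [j _|u w|c _].
- by rewrite mxE.
- exact: vanishesD.
- by apply/vanishes_unit/hA; rewrite leq_addr ltn_add2l /=.
Qed.

Lemma weight0 : weight (0 : hypercube N) = 0%N.
Proof.
rewrite /weight; apply: eq_card0 => i; rewrite !inE mxE.
exact/negbTE/negP/eqP.
Qed.

Lemma weightD1 u c : (c < N)%N -> vanishes (pred1 c) u ->
  weight (u + unit_vec c) = (weight u).+1.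
Proof.
move=> cN hu; pose c' := Ordinal cN.
rewrite /weight (_ : [set i | _]%SET = (c' |: [set i | u ord0 i == 1])%SET).
  by rewrite cardsU1 inE (hu c') /=; last exact: eqxx.
apply/setP => i; rewrite !inE !mxE (_ : (i == c') = (i == c :> nat))//.
case: (eqVneq (i : nat) c) => [ic|_].
  by rewrite (hu i) ?add0r ?eqxx//= ic eqxx.
by rewrite addr0.
Qed.

Lemma weightD_block u a z : (a + z <= N)%N ->
  vanishes (fun c => (a <= c < a + z)%N) u ->
  weight (u + block_vec a z) = (weight u + z)%N.
Proof.
elim: z => [|z IH] azN hu; first by rewrite /block_vec big_ord0 addr0 addn0.
rewrite /block_vec big_ord_recr/= addrA -/(block_vec a z) weightD1; last 2 first.
- by lia.
- apply: vanishesD; first by apply: vanishes_sub hu => j /eqP->; lia.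
  by apply: vanishes_block => c hc /=; lia.
rewrite IH; [lia|lia|].
by apply: vanishes_sub hu => j; lia.
Qed.

Lemma ex_weight k : (k <= N)%N -> exists w, weight w = k.
Proof.
move=> kN; exists (0 + block_vec 0 k); rewrite weightD_block ?weight0//.
by move=> j _; rewrite mxE.
Qed.

(** The coordinates from [a] on are cut into consecutive groups of size [g], and step [l] flips one
    coordinate of group [l]. A step followed by a reversed one flips two coordinates of the group or
    none. *)
Definition walk_vec (a g l : nat) (i : 'I_g) : hypercube N :=
  unit_vec (a + g * l + i).

Lemma weight_walk_pair a g l (i i' : 'I_g) u :
  (a + g * l.+1 <= N)%N -> i != i' ->
  vanishes (fun c => (a + g * l <= c < a + g * l.+1)%N) u ->
  weight (u + walk_vec a l i - walk_vec a l i') = (weight u + 2)%N.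
Proof.
move=> aN ii' hu; have := ltn_ord i; have := ltn_ord i' => i'g ig.
rewrite cube_oppr weightD1; last 2 first.
- by lia.
- apply: vanishesD; first by apply: vanishes_sub hu => j /eqP->; lia.
  by apply: vanishes_unit => /=; apply: contra ii' => /eqP/addnI/val_inj->.
rewrite weightD1 ?addn2//; first by lia.
by apply: vanishes_sub hu => j /eqP->; lia.
Qed.

Lemma vanishes_walk_pair (A : pred nat) a g l (i i' : 'I_g) u :
  (forall c, (a + g * l <= c < a + g * l.+1)%N -> ~~ A c) ->
  vanishes A u -> vanishes A (u + walk_vec a l i - walk_vec a l i').
Proof.
move=> hA hu; rewrite cube_oppr; have := ltn_ord i; have := ltn_ord i' => i'g ig.
by apply: vanishesD; [apply: vanishesD => //|]; apply/vanishes_unit/hA; lia.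
Qed.

Section Lower.
Context {R : realType}.

(** Each of the [k] pairs of steps adds 2 to the weight unless it cancels, which has probability
    [1 / g]. By the union bound all succeed with probability at least [1 - k / g]; other outcomes
    contribute at least 0. *)
Lemma walk_sphere_ge a g k u (s : nat -> R) : (0 < g)%N ->
  (a + g * k <= N)%N -> vanishes (fun c => (a <= c < a + g * k)%N) u ->
  (forall j, 0 <= s j) ->
  (1 - k%:R / g%:R) * s (weight u + 2 * k)%N <=
  fwd (@walk_vec a g) k (bwd (@walk_vec a g) k (s \o @weight N)) u.
Proof.
move=> g0 + + s0; elim: k u => [|k IH] u aN hu.
  by rewrite mul0r subr0 mul1r muln0 addn0.
rewrite fwd_bwdS.
have gi1 : g%:R^-1 <= 1 :> R by rewrite invf_le1 ?ler1n ?ltr0n.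
have gi0 : 0 <= g%:R^-1 :> R by rewrite invr_ge0 ler0n.
have := @step_pair_ge R _ 'I_g (walk_vec a k)
  (fwd (@walk_vec a g) k (bwd (@walk_vec a g) k (s \o @weight N))) u 0
  ((1 - k%:R / g%:R) * s (weight u + 2 * k.+1)%N).
rewrite card_ord g0 mulr0 add0r => /(_ isT).
move=> H; apply: le_trans (H _ _).
(* Bernoulli's inequality, one factor at a time: [(1 - 1/g) (1 - k/g) >= 1 - (k + 1)/g]. *)
- rewrite mulrA ler_wpM2r// -natr1.
  have : 0 <= k%:R * g%:R^-1 * g%:R^-1 :> R by rewrite !mulr_ge0.
  lra.
- by apply: fwd_ge0 => x; apply: bwd_ge0 => y /=.
- move=> i i' ii'.
  rewrite (_ : (weight u + 2 * k.+1 =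
    weight (u + walk_vec a k i - walk_vec a k i') + 2 * k)%N); last first.
    rewrite weight_walk_pair//; first lia.
    by apply: vanishes_sub hu => j; lia.
  apply: IH; first lia.
  apply: vanishes_walk_pair => [c|]; first by lia.
  by apply: vanishes_sub hu => j; lia.
Qed.

(* Chebyshev's inequality in inductive form: after [b] steps the weight is
   [weight u + 2 Bin(b, 1/2)], whose variance is [b]. *)
Lemma walk_binomial_ge M b u (h : hypercube N -> R) (c e t : R) :
  (2 * b <= M)%N -> (M <= N)%N ->
  vanishes (fun j => (j < 2 * b)%N || (M <= j)%N) u -> ~~ odd (weight u) ->
  (forall y, vanishes (leq M) y -> ~~ odd (weight y) ->
     c * (1 - e * ((weight y)%:R - t) ^+ 2) <= h y) ->
  c * (1 - e * (((weight u)%:R + b%:R - t) ^+ 2 + b%:R)) <=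
  fwd (@walk_vec 0 2) b (bwd (@walk_vec 0 2) b h) u.
Proof.
move=> + MN + + le_h; elim: b u => [|b IH] u bM hu ou.
  by rewrite !addr0; apply: le_h => //; apply: vanishes_sub hu => j /= ->; rewrite orbT.
rewrite fwd_bwdS.
have W (i i' : 'I_2) : i != i' ->
    weight (u + walk_vec 0 b i - walk_vec 0 b i') = (weight u + 2)%N.
  move=> ii'; apply: weight_walk_pair => //; first lia.
  by apply: vanishes_sub hu => j; lia.
have := @step_pair_ge R _ 'I_2 (walk_vec 0 b)
  (fwd (@walk_vec 0 2) b (bwd (@walk_vec 0 2) b h)) u
  (c * (1 - e * (((weight u)%:R + b%:R - t) ^+ 2 + b%:R)))
  (c * (1 - e * (((weight u + 2)%:R + b%:R - t) ^+ 2 + b%:R))).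
rewrite card_ord => /(_ isT) H; apply: le_trans (H _ _).
(* The pair adds 0 or 2 with probability 1/2 each, and the mean of [y ^ 2] and [(y + 2) ^ 2] is
   [(y + 1) ^ 2 + 1]: mean and variance both grow by 1. *)
- rewrite -natr1 natrD le_eqVlt; apply/orP; left; apply/eqP; by field.
- apply: IH => //; first lia.
  by apply: vanishes_sub hu => j; lia.
- move=> i i' ii'; rewrite -(W _ _ ii'); apply: IH; first lia.
    apply: vanishes_walk_pair => [c'|]; first lia.
    by apply: vanishes_sub hu => j; lia.
  by rewrite W// oddD/= addbF.
Qed.

(** [i.1] gives the bulk of the radius in multiples of [2 * L ^ 2], and [i.2] its parity; 24
    multiples cover all radii below [48 * L ^ 2]. A block that overruns [N] is cut off there. *)
Definition shift_vec (L : nat) (i : 'I_24 * bool) : hypercube N :=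
  block_vec (12 * L ^ 2) (2 * L ^ 2 * i.1 + i.2).

(* The outer walk uses the coordinates in [0, 4L^2), the inner one those in
   [4L^2, 12L^2), and the translations those from 12L^2 on. *)
Definition dominating_max (L : nat) (f : hypercube N -> R) : hypercube N -> R :=
  walk_max (@walk_vec 0 2) (2 * L ^ 2)
    (walk_max (@walk_vec (4 * L ^ 2) (4 * L)) (2 * L) (step (shift_vec L) f)).

(** Of the factor 96, 48 is the number of translations, one of which is [(i, eps)]. The other 2 is
    the success probability of a walk of at most [2 * L] steps in groups of size [4 * L]. *)
Lemma inner_max_ge L (i : 'I_24) (eps : bool) rho u (s : nat -> R) :
  (0 < L)%N -> (forall j, 0 <= s j) ->
  (12 * L ^ 2 + (2 * L ^ 2 * i + eps) <= N)%N ->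
  vanishes (leq (4 * L ^ 2)) u -> ~~ odd (weight u) ->
  (weight u <= 2 * rho <= weight u + 2 * (2 * L))%N ->
  s (2 * L ^ 2 * i + eps + 2 * rho)%N / 96 <=
  walk_max (@walk_vec (4 * L ^ 2) (4 * L)) (2 * L)
    (step (shift_vec L) (s \o @weight N)) u.
Proof.
move=> L0 s0 le_N hu ou /andP[le1 le2].
pose z := (2 * L ^ 2 * i + eps)%N; pose zeta := shift_vec L (i, eps).
pose m := ((weight u)./2)%N.
have um : weight u = (2 * m)%N by rewrite -[LHS]even_halfK// mul2n.
(* The number of steps that lifts the weight from [2 * m] to exactly [2 * rho]. *)
pose k := (rho - m)%N.
have kL : (k <= 2 * L)%N by rewrite /k; lia.
have kLL : (4 * L * k <= 8 * L ^ 2)%N.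
  rewrite (_ : 8 * L ^ 2 = 4 * L * (2 * L))%N ?leq_mul//.
  by rewrite -mulnn; lia.
apply: le_trans (walk_max_ge _ _ _ kL).
pose s' j := s j / 48.
have s'0 j : 0 <= s' j by rewrite divr_ge0.
set D := fun h : hypercube N -> R =>
  fwd (walk_vec (4 * L ^ 2) (g := 4 * L)) k
   (bwd (walk_vec (4 * L ^ 2) (g := 4 * L)) k h).
apply: (@le_trans _ _ (D (fun y => (s' \o @weight N) (zeta + y)) u)); last first.
  apply: ler_fwd => y; apply: ler_bwd => {}y.
  have := @mean_ge_term R _ (fun j => (s \o @weight N) (y + shift_vec L j)) (i, eps).
  rewrite card_prod card_ord card_bool /= addrC; apply => j; exact: s0.
rewrite /D bwd_shift fwd_shift.
have wz : weight (zeta + u) = (2 * m + z)%N.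
  rewrite addrC weightD_block//=; first by rewrite um.
  by apply: vanishes_sub hu => j; lia.
apply: le_trans (walk_sphere_ge _ _ _ _) => //.
- rewrite wz (_ : 2 * m + z + 2 * k = z + 2 * rho)%N; last by rewrite /z /k; lia.
  rewrite /s' -/z; have := s0 (z + 2 * rho)%N; set S := s _ => S0.
  have : k%:R / (4 * L)%:R <= 1 / 2 :> R.
    rewrite ler_pdivrMr ?ltr0n ?muln_gt0// natrM.
    have : k%:R <= (2 * L)%:R :> R by rewrite ler_nat.
    rewrite natrM; lra.
  set q := k%:R / _ => q2.
  have : 0 <= (1 / 2 - q) * S by rewrite mulr_ge0 ?subr_ge0.
  lra.
- by rewrite muln_gt0.
- lia.
- apply: vanishesD; last by apply: vanishes_sub hu => j; lia.
  by apply: vanishes_block => c; lia.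
Qed.

(** By Chebyshev's inequality the outer walk enters the window of [inner_max_ge] with probability at
    least 1/2, so 96 becomes 192. *)
Lemma dominating_max_ge L k (s : nat -> R) :
  (0 < L)%N -> (24 * L ^ 2 <= N)%N -> (2 * k <= N)%N -> (k < 48 * L ^ 2)%N ->
  (forall j, 0 <= s j) ->
  s k / 192 <= dominating_max L (s \o @weight N) 0.
Proof.
move=> L0 LN kN kL s0.
have LL : (0 < 2 * L ^ 2)%N by rewrite muln_gt0 expn_gt0 L0.
have i24 : (k %/ (2 * L ^ 2) < 24)%N by rewrite ltn_divLR//; lia.
pose i := Ordinal i24; pose r := (k %% (2 * L ^ 2))%N.
have rL : (r < 2 * L ^ 2)%N by rewrite ltn_mod.
pose rho := r./2.
have ek : k = (2 * L ^ 2 * i + odd r + 2 * rho)%N.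
  have er : r = (odd r + 2 * rho)%N by rewrite mul2n odd_double_half.
  by rewrite /= -addnA -er mulnC; exact: divn_eq.
rewrite {1}ek /dominating_max.
set g := walk_max _ _ (step _ _).
have g_ge u : vanishes (leq (4 * L ^ 2)) u -> ~~ odd (weight u) ->
    (weight u <= 2 * rho <= weight u + 2 * (2 * L))%N ->
    s (2 * L ^ 2 * i + odd r + 2 * rho)%N / 96 <= g u.
  (* The translation block fits because [12 * L ^ 2] and [k] are both at most [N / 2]; here the
     bound on the radius is used. *)
  by apply: inner_max_ge => //; lia.
have g0 u : 0 <= g u.
  by apply: walk_max_ge0 => y; apply: step_ge0 => ?; exact: s0.
have S0 := s0 (2 * L ^ 2 * i + odd r + 2 * rho)%N.
set S := s _ in S0 g_ge *.
have v0 A : vanishes A 0 by move=> j _; rewrite mxE.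
(* For [rho <= L] the inner walk suffices, and the outer walk takes no step. *)
have [rho_le|rho_gt] := leqP (2 * rho) (2 * L).
  apply: le_trans (@walk_max_ge _ _ _ _ 0 _ _ _ _) => //=.
  apply: le_trans (g_ge 0 _ _ _); rewrite ?weight0//; [lra|lia].
(* The mean weight after [b] steps is [b], the centre of the window from [2 * rho - 4 * L] to
   [2 * rho]. The variance [b] is at most half the squared half-width [K2]. *)
pose b := (2 * rho - 2 * L)%N.
have bL : (b <= 2 * L ^ 2)%N by rewrite /b; lia.
apply: le_trans (walk_max_ge _ _ _ bL).
pose K2 : R := (2 * L)%:R ^+ 2.
have K20 : 0 < K2 by rewrite exprn_gt0// ltr0n muln_gt0.
have := @walk_binomial_ge (4 * L ^ 2) b 0 g (S / 96) K2^-1 b%:R.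
rewrite weight0 add0r subrr expr0n/= add0r => H.
apply: le_trans (H _ _ _ _ _) => //.
- have : K2^-1 * b%:R <= 1 / 2.
    rewrite mulrC ler_pdivrMr//.
    have : b%:R <= (2 * L ^ 2)%:R :> R by rewrite ler_nat.
    rewrite /K2 !natrM; nra.
  set q := _ * _ => q2.
  have : 0 <= (1 / 2 - q) * S by rewrite mulr_ge0 ?subr_ge0.
  lra.
- lia.
- lia.
- move=> y hy oy.
  have [win|nwin] := boolP (weight y <= 2 * rho <= weight y + 2 * (2 * L))%N.
    apply: le_trans (g_ge y hy oy win).
    have : 0 <= S / 96 * (K2^-1 * ((weight y)%:R - b%:R) ^+ 2).
      apply: mulr_ge0; first lra.
      by rewrite mulr_ge0 ?sqr_ge0// invr_ge0 ltW.
    lra.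
  (* Outside the window the quadratic minorant is nonpositive. *)
  apply: le_trans (g0 y).
  rewrite mulr_ge0_le0//; first lra.
  rewrite subr_le0 mulrC ler_pdivlMr// mul1r /K2.
  have : (2 * L + b <= weight y)%N || (2 * L + weight y <= b)%N by rewrite /b; lia.
  rewrite -subr_ge0 subr_sqr; have K0 := ler0n R (2 * L).
  case/orP; rewrite -(ler_nat R) natrD => hw.
    by apply: mulr_ge0; lra.
  by apply: mulr_le0; lra.
Qed.

End Lower.
End Cube.

(** * Spherical means as averages over permutations of the coordinates *)

Section Sphere.
Context {N : nat}.
Implicit Types x y w : hypercube N.

Lemma weight_col_perm (s : 'S_N) w : weight (col_perm s w) = weight w.
Proof.
rewrite /weight (_ : [set i | _]%SET = s @^-1: [set i | w ord0 i == 1])%SET.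
  by apply: card_preimset; exact: perm_inj.
by apply/setP => i; rewrite !inE mxE.
Qed.

Lemma weight_count w : weight w = count_mem (1%R : 'F_2) [tuple w ord0 i | i < N].
Proof.
rewrite /weight cardE /enum_mem size_filter count_map /= enumT.
by apply: eq_count => i; rewrite !inE.
Qed.

Lemma ex_col_perm w w' : weight w = weight w' -> exists s : 'S_N, w' = col_perm s w.
Proof.
move=> ww'.
have /tuple_permP[s es] :
    perm_eq [tuple w' ord0 i | i < N] [tuple w ord0 i | i < N].
  have E1 : count_mem (1%R : 'F_2) [tuple w' ord0 i | i < N] =
            count_mem (1%R : 'F_2) [tuple w ord0 i | i < N].
    by rewrite -!weight_count.
  have E0 (u : hypercube N) : count_mem (0%R : 'F_2) [tuple u ord0 i | i < N] =
      (N - count_mem (1%R : 'F_2) [tuple u ord0 i | i < N])%N.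
    set t := [tuple u ord0 i | i < N].
    have := count_predC (pred1 (1%R : 'F_2)) t; rewrite size_tuple.
    move=> /(congr1 (subn^~ (count_mem 1%R t))); rewrite addKn => <-.
    by apply: eq_count => b /=; case: (F2_cases b) => ->.
  rewrite /perm_eq; apply/allP => b _ /=.
  by case: (F2_cases b) => ->; rewrite ?E0 E1.
exists s; apply/rowP => j; rewrite mxE.
by have := congr1 (fun t : N.-tuple 'F_2 => tnth t j) (val_inj es); rewrite !tnth_mktuple.
Qed.

Context {R : realType}.

Definition sphere_mean (k : nat) (f : hypercube N -> R) x : R :=
  'C(N, k)%:R^-1 * \sum_y f (x - y) * (weight y == k)%:R.

Lemma card_sphere k : (k <= N)%N -> #|[set y : hypercube N | weight y == k]| = 'C(N, k).
Proof.
move=> kN; rewrite -[N in RHS]card_ord -card_draws.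
pose phi (y : hypercube N) := [set i | y ord0 i == 1]%SET.
rewrite -(card_in_imset (f := phi)); last first.
  move=> y y' _ _ /setP e; apply/rowP => i; have := e i; rewrite !inE.
  by case: (F2_cases (y ord0 i)) => ->; case: (F2_cases (y' ord0 i)) => ->.
apply: eq_card => A; rewrite !inE; apply/imsetP/idP => [[y]|/eqP Ak].
  by rewrite inE => yk ->.
have eA : phi (\row_i (i \in A)%:R) = A.
  by apply/setP => i; rewrite !inE mxE; case: (i \in A).
by exists (\row_i (i \in A)%:R); rewrite // inE /weight -/(phi _) eA Ak.
Qed.

(** The left side depends on [w] only through its weight, so it may be averaged over the sphere;
    each permutation then merely rearranges that sphere. *)
Lemma mean_col_perm (f : hypercube N -> R) x w :
  mean (fun s : 'S_N => f (x + col_perm s w)) = sphere_mean (weight w) f x.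
Proof.
set k := weight w; pose A y := mean (fun s : 'S_N => f (x + col_perm s y)).
have A_radial y : weight y = k -> A y = A w.
  move=> /esym/ex_col_perm[t ->]; rewrite /A /mean; congr (_ / _).
  rewrite [RHS](reindex_inj (mulIg t)); apply: eq_bigr => s _.
  by rewrite col_permM.
have kN : (k <= N)%N by rewrite -[leqRHS]card_ord max_card.
have C0 : 'C(N, k)%:R != 0 :> R by rewrite pnatr_eq0 -lt0n bin_gt0.
apply: (mulfI C0); rewrite /sphere_mean mulVKf//.
rewrite -/(A w) mulrC.
transitivity (\sum_(y : hypercube N | weight y == k) A y).
  rewrite (eq_bigr (fun=> A w)) => [|y /eqP/A_radial//].
  by rewrite sumr_const -(card_sphere kN) cardsE mulr_natr.
transitivity (mean (fun s : 'S_N => \sum_y f (x - y) * (weight y == k)%:R)).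
  rewrite big_mkcond /=.
  rewrite -(sum_mean (fun (s : 'S_N) y => f (x - y) * (weight y == k)%:R)).
  rewrite [LHS](eq_bigr (fun y => mean (fun s : 'S_N =>
    f (x + col_perm s y) * (weight y == k)%:R))); last first.
    move=> y _; case: eqP => _.
      by apply: eq_mean => s; rewrite mulr1.
    rewrite -[LHS](@mean_cst _ 'S_N) ?card_Sn ?fact_gt0//.
    by apply: eq_mean => s; rewrite mulr0.
  rewrite (sum_mean (fun (s : 'S_N) y => f (x + col_perm s y) * (weight y == k)%:R)).
  rewrite (sum_mean (fun (s : 'S_N) y => f (x - y) * (weight y == k)%:R)).
  apply: eq_mean => s.
  have inj_s : injective (@col_perm 'F_2 1 N s).
    apply: (can_inj (g := col_perm s^-1)) => y.
    by rewrite -col_permM mulVg col_perm1.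
  rewrite [RHS](reindex_inj inj_s); apply: eq_bigr => y _.
  by rewrite weight_col_perm cube_oppr.
by rewrite mean_cst// card_Sn fact_gt0.
Qed.

Lemma sphere_mean_ge0 (f : hypercube N -> R) k x :
  (forall x, 0 <= f x) -> 0 <= sphere_mean k f x.
Proof. by move=> f0; rewrite mulr_ge0 ?invr_ge0// sumr_ge0// => y _; rewrite mulr_ge0. Qed.

Lemma col_permK (s : 'S_N) :
  cancel (@col_perm 'F_2 1 N s) (@col_perm 'F_2 1 N s^-1).
Proof. by move=> y; rewrite -col_permM mulVg col_perm1. Qed.

Lemma dominating_max_mean (W : finType) L (h : W -> hypercube N -> R) x :
  dominating_max L (fun y => mean (h^~ y)) x <=
  mean (fun o => dominating_max L (h o) x).
Proof.
apply: le_trans (walk_max_mean _ _ _ _); apply: ler_walk_max => y.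
by apply: le_trans (walk_max_mean _ _ _ _); rewrite step_mean.
Qed.

Lemma dominating_max_shift L (h : hypercube N -> R) x :
  dominating_max L (fun y => h (x + y)) 0 = dominating_max L h x.
Proof. by rewrite /dominating_max step_shift !walk_max_shift addr0. Qed.

(** [dominating_max_ge] is applied to the radial function of [y] obtained by averaging
    [f (x + col_perm s y)] over [s]. Sublinearity takes this average outside, and each term is the
    maximal function conjugated by a permutation. *)
Lemma sphere_mean_le (f : hypercube N -> R) k x L :
  (0 < L)%N -> (24 * L ^ 2 <= N < 96 * L ^ 2)%N -> (2 * k <= N)%N ->
  (forall x, 0 <= f x) ->
  sphere_mean k f x <= 192 * mean (fun s : 'S_N =>
    dominating_max L (f \o col_perm s) (col_perm s^-1 x)).
Proof.
move=> L0 /andP[LN NL] kN f0.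
have kL : (k < 48 * L ^ 2)%N by lia.
have := dominating_max_ge L0 LN kN kL (fun j => sphere_mean_ge0 j x f0).
rewrite (_ : _ \o _ = fun y => mean (fun s : 'S_N => f (x + col_perm s y))); last first.
  by apply/funext => y; rewrite mean_col_perm.
move=> /le_trans/(_ (dominating_max_mean _ (fun (s : 'S_N) y => f (x + col_perm s y)) _)).
rewrite (eq_mean (G := fun s : 'S_N =>
    dominating_max L (f \o col_perm s) (col_perm s^-1 x))); first lra.
move=> s; rewrite -[RHS]dominating_max_shift; congr (dominating_max L _ 0).
apply/funext => y /=; rewrite raddfD /=; congr (f (_ + _)).
by rewrite -col_permM mulgV col_perm1.
Qed.

Lemma dominating_max_ge0 L (f : hypercube N -> R) x :
  (forall x, 0 <= f x) -> 0 <= dominating_max L f x.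
Proof. by move=> f0; do 2!apply: walk_max_ge0 => ?; exact: step_ge0. Qed.

Lemma sum_dominating_max_le L (p : R) (f : hypercube N -> R) :
  (0 < L)%N -> 1 < p -> (forall x, 0 <= f x) ->
  \sum_x dominating_max L f x `^ p <=
  ((p / (p - 1)) `^ p) ^+ 2 * \sum_x f x `^ p.
Proof.
move=> L0 p1 f0; have q0 := powR_ge0 (p / (p - 1)) p.
have F0 x : 0 <= step (shift_vec L) f x by exact: step_ge0.
apply: le_trans (sum_walk_max_le _ _ _ p1 _) _; first by rewrite card_ord.
  exact: walk_max_ge0.
rewrite expr2 -mulrA ler_wpM2l//.
apply: le_trans (sum_walk_max_le _ _ _ p1 F0) _; first by rewrite card_ord muln_gt0.
by rewrite ler_wpM2l// sum_step_powR_le// card_prod card_ord card_bool.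
Qed.

(** The last hypothesis on [M] expresses a supremum over radii at most [N / 2] by its defining
    property. Conjugation by a permutation preserves sums of [p]-th powers, so Jensen's inequality
    reduces the average to one dominating maximal function. *)
Lemma sum_maximal_le_large L (p : R) (f M : hypercube N -> R) :
  (0 < L)%N -> (24 * L ^ 2 <= N < 96 * L ^ 2)%N -> 1 < p ->
  (forall x, 0 <= f x) -> (forall x, 0 <= M x) ->
  (forall x B, (forall k, (2 * k <= N)%N -> sphere_mean k f x <= B) -> M x <= B) ->
  \sum_x M x `^ p <=
  192 `^ p * ((p / (p - 1)) `^ p) ^+ 2 * \sum_x f x `^ p.
Proof.
move=> L0 LN p1 f0 M0 Msup.
pose h (s : 'S_N) x := dominating_max L (f \o col_perm s) (col_perm s^-1 x).
have h0 s x : 0 <= h s x by apply: dominating_max_ge0 => y /=.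
have SN : (0 < #|{: 'S_N}|)%N by rewrite card_Sn fact_gt0.
rewrite -mulrA; apply: (@le_trans _ _ (192 `^ p * \sum_x mean (h^~ x) `^ p)).
  rewrite mulr_sumr; apply: ler_sum => x _.
  have m0 : 0 <= mean (h^~ x) by apply: mean_ge0.
  rewrite -powRM//; apply: ge0_ler_powR; rewrite ?nnegrE//.
  - by lra.
  - exact: mulr_ge0.
  - by apply: Msup => k kN; exact: sphere_mean_le.
rewrite ler_wpM2l ?powR_ge0//.
apply: (@le_trans _ _ (\sum_x mean (fun s => h s x `^ p))).
  by apply: ler_sum => x _; exact: powR_mean_le.
rewrite (sum_mean (fun s x => h s x `^ p)) -[leRHS](mean_cst _ SN).
apply: ler_mean => s; rewrite (reindex_inj (can_inj (@col_permK s))) /=.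
rewrite (eq_bigr (fun x => dominating_max L (f \o col_perm s) x `^ p)); last first.
  by move=> x _; rewrite /h col_permK.
rewrite [leRHS](_ : _ = ((p / (p - 1)) `^ p) ^+ 2 * \sum_x (f \o col_perm s) x `^ p).
  by apply: sum_dominating_max_le => // x /=.
by congr (_ * _); rewrite (reindex_inj (can_inj (@col_permK s))).
Qed.

(** A crude bound for small [N]: every spherical mean is at most the [p]-norm of [f], and there are
    [2 ^ N] points. *)
Lemma sum_maximal_le_card (p : R) (f M : hypercube N -> R) :
  1 < p -> (forall x, 0 <= f x) -> (forall x, 0 <= M x) ->
  (forall x B, (forall k, (2 * k <= N)%N -> sphere_mean k f x <= B) -> M x <= B) ->
  \sum_x M x `^ p <= 2 ^+ N * \sum_x f x `^ p.
Proof.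
move=> p1 f0 M0 Msup; set S := \sum_x f x `^ p.
have p0 : p != 0 by lra.
have S0 : 0 <= S by rewrite sumr_ge0// => x _; exact: powR_ge0.
have f_le y : f y <= S `^ p^-1.
  rewrite -[f y]powRr1// -(mulfV p0) powRrM.
  apply: ge0_ler_powR; rewrite ?nnegrE ?powR_ge0 ?invr_ge0//; first lra.
  by rewrite /S (bigD1 y)//= lerDl sumr_ge0// => x _; exact: powR_ge0.
have M_le x : M x `^ p <= S.
  rewrite -[leRHS]powRr1// -(mulVf p0) powRrM.
  apply: ge0_ler_powR; rewrite ?nnegrE ?powR_ge0//; first lra.
  apply: Msup => k kN.
  have [|w <-] := @ex_weight N k; first lia.
  rewrite -mean_col_perm -[leRHS](@mean_cst _ 'S_N) ?card_Sn ?fact_gt0//.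
  exact: ler_mean.
apply: le_trans (ler_sum _ (fun x _ => M_le x)) _.
by rewrite sumr_const card_mx card_Fp// mul1n -[S *+ _]mulr_natl natrX.
Qed.

End Sphere.

(** * Choice of the scale [L] and a constant uniform in [N] *)

Lemma sum_maximal_le (R : realType) (p : R) : 1 < p ->
  exists2 C : R, 0 < C & forall N (f M : hypercube N -> R),
  (forall x, 0 <= f x) -> (forall x, 0 <= M x) ->
  (forall x B, (forall k, (2 * k <= N)%N -> sphere_mean k f x <= B) -> M x <= B) ->
  \sum_x M x `^ p <= C * \sum_x f x `^ p.
Proof.
move=> p1; pose C0 := 192 `^ p * ((p / (p - 1)) `^ p) ^+ 2.
have C00 : 0 <= C0 by rewrite mulr_ge0 ?exprn_ge0 ?powR_ge0.
have T0 : 0 < 2 ^+ 24 :> R by rewrite exprn_gt0.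
exists (C0 + 2 ^+ 24) => [|N f M f0 M0 Msup]; first by rewrite ltr_wpDl.
have S0 : 0 <= \sum_x f x `^ p by rewrite sumr_ge0// => x _; exact: powR_ge0.
have [N24|N24] := ltnP N 24.
  apply: le_trans (sum_maximal_le_card p1 f0 M0 Msup) _.
  rewrite ler_wpM2r//; apply: (@le_trans _ _ (2 ^+ 24)); last by rewrite lerDr.
  by rewrite ler_weXn2l ?ler1n// ltnW.
have exL : exists L, (24 * L ^ 2 <= N)%N by exists 1%N.
have ubL L : (24 * L ^ 2 <= N)%N -> (L <= N)%N.
  by apply: leq_trans; rewrite -mulnn; nia.
(* For the largest such [L], [N < 24 * (L + 1) ^ 2 <= 96 * L ^ 2], because [L + 1 <= 2 * L]. *)
case: (ex_maxnP exL ubL) => L LN Lmax.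
have L0 : (0 < L)%N by apply: Lmax.
have NL : (N < 96 * L ^ 2)%N.
  apply: (@leq_trans (24 * L.+1 ^ 2)).
    by rewrite ltnNge; apply/negP => /Lmax; rewrite ltnn.
  by rewrite -!mulnn; nia.
apply: le_trans (sum_maximal_le_large L0 _ p1 f0 M0 Msup) _; first by rewrite LN.
by rewrite -/C0 ler_wpM2r// lerDl ltW.
Qed.

(** * Reduction from complex functions to their moduli *)

Lemma normc_ge0 (R : rcfType) (z : R[i]) : 0 <= Normc.normc z.
Proof. by case: z => a b; exact: sqrtr_ge0. Qed.

Lemma normc_real (R : rcfType) (r : R) : Normc.normc r%:C = `|r|.
Proof. by rewrite /Normc.normc /= expr0n addr0 sqrtr_sqr. Qed.

Lemma normc_nat (R : rcfType) (n : nat) : Normc.normc (n%:R : R[i]) = n%:R.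
Proof. by rewrite -(rmorph_nat (real_complex R)) normc_real ger0_norm. Qed.

Lemma normc_sum_le (R : rcfType) (I : finType) (F : I -> R[i]) :
  Normc.normc (\sum_i F i) <= \sum_i Normc.normc (F i).
Proof.
elim/big_ind2: _ => [|a b c d ab cd|//]; first by rewrite Normc.normc0.
exact: le_trans (le_normcD _ _) (lerD ab cd).
Qed.

Lemma normc_conv_le (R : realType) N k (f : hypercube N -> R[i]) x :
  Normc.normc (conv (sphere_avg R k) f x) <=
  sphere_mean k (fun y => Normc.normc (f y)) x.
Proof.
apply: le_trans (normc_sum_le _) _.
rewrite /sphere_mean mulr_sumr; apply: ler_sum => y _.
by rewrite /sphere_avg !Normc.normcM Normc.normcV !normc_nat mulrCA.
Qed.

Theorem theorem2p5 (R : realType) (p : R) (hp : 1 < p) :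
  exists2 C : R, 0 < C &
    forall (N : nat) (hN : (1 <= N)%N) (f : hypercube N -> R[i]),
      Lp_norm p (fun x => (spherical_maximal f x)%:C) <= C * Lp_norm p f.
Proof.
have [C C0 HC] := sum_maximal_le hp.
exists (C `^ p^-1) => [|N _ f]; first exact: powR_gt0.
have half k : (k%:R <= N%:R / 2 :> R) = (2 * k <= N)%N.
  by rewrite ler_pdivlMr// -natrM ler_nat mulnC.
(* The supremum is usable once the set is known to be nonempty and bounded; the sum of the values
   over all [k <= N] is an upper bound. *)
have maxP x : has_sup [set Normc.normc (conv (sphere_avg R k) f x)
    | k in [set k : nat | k%:R <= N%:R / 2 :> R]]%classic.
  split; first by eexists; exists 0%N => //=; rewrite half.
  exists (\sum_(k < N.+1) Normc.normc (conv (sphere_avg R k) f x)).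
  move=> _ [k /= + <-]; rewrite half => kN.
  have kN1 : (k < N.+1)%N by lia.
  rewrite (bigD1 (Ordinal kN1))//= lerDl sumr_ge0// => i _; exact: normc_ge0.
have max0 x : 0 <= spherical_maximal f x.
  apply: (@le_trans _ _ (Normc.normc (conv (sphere_avg R 0) f x))).
    exact: normc_ge0.
  by apply: (ub_le_sup (maxP x).2); exists 0%N => //=; rewrite half.
rewrite /Lp_norm (eq_bigr (fun x => spherical_maximal f x `^ p)); last first.
  by move=> x _; rewrite normc_real ger0_norm.
have sum0 (g : hypercube N -> R) : 0 <= \sum_x g x `^ p.
  by rewrite sumr_ge0// => x _; exact: powR_ge0.
have C0' := ltW C0.
rewrite -powRM//; apply: ge0_ler_powR; rewrite ?nnegrE ?sum0 ?mulr_ge0 ?invr_ge0//.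
  lra.
apply: HC => // [x|x B hB]; first exact: normc_ge0.
apply: ge_sup; first exact: (maxP x).1.
move=> _ [k /= + <-]; rewrite half => kN.
exact: le_trans (normc_conv_le _ _ _) (hB k kN).
Qed.
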